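(* Let $\mathbf P=(P,\leq,{}')$ be a poset with an antitone involution $'$. Then its Dedekind-MacNeille completion $\mathrm{BDM}(\mathbf P)=(\mathrm{DM}(\mathbf P),\subseteq,{}^* )$ is a consistent lattice if and only if $\mathbf P$ is a consistent poset.
   Context: For $A\subseteq P$: $L(A)=\{x\in P\mid x\leq a\ \forall a\in A\}$, $U(A)=\{x\in P\mid a\leq x\ \forall a\in A\}$, $A'=\{a'\mid a\in A\}$. An antitone involution satisfies $x\leq y\Rightarrow y'\leq x'$ and $x''=x$. $\mathrm{DM}(\mathbf P)=\{L(A)\mid A\subseteq P\}$, ordered by inclusion (a complete lattice with meet $\cap$ and join $A\vee B=LU(A\cup B)$), with $A^*=L(A')$ for $A\in\mathrm{DM}(\mathbf P)$; $^*$ is an antitone involution on it. A consistent poset is a bounded poset $(P,\leq,{}',0,1)$ with an antitone involution such that $L(x,x')=L(y,y')$ for all $x,y\in P\setminus\{0,1\}$ and $L(x,y)\neq\{0\}$ for all $x,y\in P\setminus\{0\}$. A consistent lattice is a bounded lattice $(L,\vee,\wedge,{}',0,1)$ with an antitone involution such that $x\wedge x'=y\wedge y'$ for all $x,y\in L\setminus\{0,1\}$ and $x\wedge y\neq0$ for all $x,y\in L\setminus\{0\}$. *)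

(* Defs.v *)
From HB Require Import structures.
From mathcomp Require Import all_boot all_order.
From mathcomp Require Import boolp classical_sets.

Set Implicit Arguments.
Unset Strict Implicit.
Unset Printing Implicit Defensive.

Import Order.TTheory.
Local Open Scope classical_set_scope.

Definition antitone_involution (d : Order.disp_t) (P : porderType d)
    (inv : P -> P) : Prop :=
  (forall x y : P, (x <= y)%O -> (inv y <= inv x)%O) /\
  (forall x : P, inv (inv x) = x).

(* Boundedness is part of the property: zero and one are (necessarily unique)
   least and greatest elements.  L(A) is lbound A. *)
Definition consistent_poset (d : Order.disp_t) (P : porderType d)
    (inv : P -> P) : Prop :=
  antitone_involution inv /\
  exists zero one : P,
    [/\ forall x : P, (zero <= x <= one)%O,
        forall x y : P, x <> zero -> x <> one -> y <> zero -> y <> one ->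
          lbound [set x; inv x] = lbound [set y; inv y] &
        forall x y : P, x <> zero -> y <> zero ->
          lbound [set x; y] <> [set zero]].

Definition consistent_lattice (d : Order.disp_t) (L : tbLatticeType d)
    (inv : L -> L) : Prop :=
  [/\ antitone_involution inv,
      forall x y : L, x <> \bot%O -> x <> \top%O -> y <> \bot%O -> y <> \top%O ->
        (x `&` inv x)%O = (y `&` inv y)%O &
      forall x y : L, x <> \bot%O -> y <> \bot%O -> (x `&` y)%O <> \bot%O].

Section DedekindMacNeille.
Context (d : Order.disp_t) (P : porderType d).

Record DM := MkDM {
  cut :> set P ;
  cutP : `[< exists A : set P, cut = lbound A >] }.

HB.instance Definition _ := [isSub for cut].
HB.instance Definition _ := [Choice of DM by <:].
HB.instance Definition _ := [SubChoice_isSubPOrder of DM by <: with set_display].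

Lemma leDM (A B : DM) : (A <= B)%O <-> cut A `<=` cut B.
Proof. by rewrite -Order.le_val subsetEset. Qed.

Lemma cut_lbound (A : DM) : exists B : set P, cut A = lbound B.
Proof. exact/asboolP/cutP. Qed.

Definition DM_lbound (A : set P) : DM :=
  MkDM (introT (asboolP _) (ex_intro _ A erefl)).

Lemma cutI_subproof (A B : DM) :
  `[< exists C : set P, cut A `&` cut B = lbound C >].
Proof.
have [[A' ->] [B' ->]] := (cut_lbound A, cut_lbound B); apply/asboolP.
exists (A' `|` B'); apply/seteqP; split => [x [xA xB] y [/xA|/xB]//|x xAB].
by split=> y ?; apply: xAB; [left|right].
Qed.

Definition DM_meet (A B : DM) : DM := MkDM (cutI_subproof A B).
Definition DM_join (A B : DM) : DM := DM_lbound (ubound (cut A `|` cut B)).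

Lemma DM_meetP (A B C : DM) :
  (A <= DM_meet B C)%O = (A <= B)%O && (A <= C)%O.
Proof.
apply/idP/andP => [/leDM AI|[/leDM AB /leDM AC]].
  by split; apply/leDM => x /AI[].
by apply/leDM => x Ax; split; [apply: AB|apply: AC].
Qed.

Lemma DM_joinP (A B C : DM) :
  (DM_join A B <= C)%O = (A <= C)%O && (B <= C)%O.
Proof.
apply/idP/andP => [/leDM JC|[/leDM AC /leDM BC]].
  by split; apply/leDM => x ?; apply: JC => y; apply; [left|right].
apply/leDM; have [C' eC] := cut_lbound C; rewrite eC in AC BC *.
move=> x xJ y Cy.
by apply: xJ => z [/AC|/BC]; apply.
Qed.

HB.instance Definition _ :=
  Order.POrder_MeetJoin_isLattice.Build set_display DM DM_meetP DM_joinP.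

Lemma DM_botP (A : DM) : (DM_lbound [set: P] <= A)%O.
Proof.
by apply/leDM; have [A' ->] := cut_lbound A; move=> x xP y _; apply: xP.
Qed.

Lemma DM_topP (A : DM) : (A <= DM_lbound set0)%O.
Proof. by apply/leDM => x _ y. Qed.

HB.instance Definition _ := Order.hasBottom.Build set_display DM DM_botP.
HB.instance Definition _ := Order.hasTop.Build set_display DM DM_topP.

Definition DM_star (inv : P -> P) (A : DM) : DM := DM_lbound (inv @` cut A).

End DedekindMacNeille.

(* Main.v *)
Require Import Defs.
From mathcomp Require Import all_boot all_order.
From mathcomp Require Import boolp classical_sets.

Set Implicit Arguments.
Unset Strict Implicit.
Unset Printing Implicit Defensive.

Local Open Scope classical_set_scope.

Import Order.TTheory.

(** The map [x |-> L(x)] embeds [P] into [DM(P)] and carries ['] to [*], so both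
    consistency conditions restrict from [DM(P)] to [P].  Boundedness of [P] is
    not preassumed: were there no least element, every [L(p)] would be a
    nontrivial cut, so [L(p) /\ L(p')] would be one nonempty set independent of
    [p], whose elements lie below all of [P].
    Conversely, for a nontrivial cut [A] and any nonzero [a] in [A], the meet
    [A /\ A*] equals [L(a, a')], which does not depend on [a] or [A]. *)

Section DedekindMacNeilleTheory.
Context (d : Order.disp_t) (P : porderType d) (inv : P -> P).
Implicit Types (A B : DM P) (x y : P).

Lemma cut_inj A B : cut A = cut B -> A = B.
Proof. exact: val_inj. Qed.

Lemma cut_le A x y : (x <= y)%O -> cut A y -> cut A x.
Proof. by have [B ->] := cut_lbound A => xy yB b /yB; apply: le_trans. Qed.

Lemma cut_bot : cut (\bot%O : DM P) = lbound setT.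
Proof. by []. Qed.

Lemma cut_top : cut (\top%O : DM P) = setT.
Proof. by apply/seteqP; split=> // x _ y. Qed.

Lemma cut_meet A B : cut (A `&` B)%O = cut A `&` cut B.
Proof. by []. Qed.

(** If A = L(B), then B lies in U(A), so LU(A) is contained in L(B). *)
Lemma cut_lbound_ubound A : lbound (ubound (cut A)) = cut A.
Proof.
apply/seteqP; split=> [|x Ax y]; last exact.
have [B ->] := cut_lbound A => x xLU b Bb.
by apply: xLU => y; exact.
Qed.

Definition principal x : DM P := DM_lbound [set x].

Lemma mem_principal x y : cut (principal x) y <-> (y <= x)%O.
Proof. by split=> [|yx _ ->]; [exact|]. Qed.

(** Turns the sets L(x, y) in the definition of a consistent poset into meets in [DM P]. *)
Lemma cut_principalI x y :
  cut (principal x `&` principal y)%O = lbound [set x; y].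
Proof.
rewrite cut_meet; apply/seteqP; split=> [z [zx zy] _ [->|->]|z zxy].
- exact: zx.
- exact: zy.
- by split=> _ ->; apply: zxy; [left|right].
Qed.

Lemma principal_eq_bot x : principal x = \bot%O -> forall y, (x <= y)%O.
Proof.
move=> xbot y; have : cut (principal x) x by apply/mem_principal.
by rewrite xbot cut_bot; exact.
Qed.

Lemma principal_eq_top x : principal x = \top%O -> forall y, (y <= x)%O.
Proof. by move=> xtop y; apply/mem_principal; rewrite xtop cut_top. Qed.

Section Involution.
Hypothesis invP : antitone_involution inv.

Let invK x : inv (inv x) = x. Proof. exact: invP.2. Qed.

Lemma le_invr x y : (x <= inv y)%O -> (y <= inv x)%O.
Proof. by move=> /invP.1; rewrite invK. Qed.

Lemma le_invl x y : (inv x <= y)%O -> (inv y <= x)%O.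
Proof. by move=> /invP.1; rewrite invK. Qed.

(** The involution exchanges lower bounds of A' with upper bounds of A, so [DM_star inv A] is
    U(A)'. *)
Lemma mem_star A x : cut (DM_star inv A) x <-> ubound (cut A) (inv x).
Proof.
split=> [xA a Aa|xA _ [a Aa <-]]; apply: le_invr; last exact: xA.
by apply: xA; exists a.
Qed.

Lemma star_principal x : DM_star inv (principal x) = principal (inv x).
Proof.
apply: cut_inj; apply/seteqP; split=> y.
  move=> /mem_star/(_ x)/= yx; apply/mem_principal/le_invr/yx.
  exact/mem_principal.
move=> /mem_principal yx; apply/mem_star => z /mem_principal zx.
exact/(le_trans zx)/le_invr.
Qed.

Lemma star_antitone_involution : antitone_involution (DM_star inv).
Proof.
split=> [A B /leDM AB|A].
  by apply/leDM => x /mem_star xB; apply/mem_star => a /AB /xB.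
(* Applying [mem_star] twice turns the double star of A into LU(A), which is A. *)
apply: cut_inj; rewrite -[RHS]cut_lbound_ubound; apply/seteqP; split=> x.
  move=> /mem_star xA y Ay; rewrite -(invK y); apply/le_invr/xA/mem_star.
  by rewrite invK.
by move=> xA; apply/mem_star => y /mem_star Ay; apply/le_invr/xA.
Qed.

End Involution.

Section Bounded.
Variables zero one : P.
Hypothesis bnd : forall x, (zero <= x <= one)%O.

Lemma cut_bot_bounded : cut (\bot%O : DM P) = [set zero].
Proof.
rewrite cut_bot; apply/seteqP; split=> [x xP|_ -> y _].
  by apply/le_anti; rewrite (xP zero)//; case/andP: (bnd x).
by case/andP: (bnd y).
Qed.

Lemma principal_neq_bot x : x <> zero -> principal x <> \bot%O.
Proof.
move=> x0 /principal_eq_bot xle; apply: x0; apply/le_anti.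
by rewrite xle; case/andP: (bnd x).
Qed.

Lemma principal_neq_top x : x <> one -> principal x <> \top%O.
Proof.
move=> x1 /principal_eq_top xge; apply: x1; apply/le_anti.
by rewrite xge; case/andP: (bnd x) => _ ->.
Qed.

Lemma cut_zero A : cut A zero.
Proof.
by have [B ->] := cut_lbound A => b _; case/andP: (bnd b).
Qed.

Lemma cut_neq_bot A : A <> \bot%O -> exists2 x, cut A x & x <> zero.
Proof.
move=> A0; apply: contrapT => noA; apply: A0; apply: cut_inj.
rewrite cut_bot_bounded; apply/seteqP; split=> [x Ax|_ ->]; last exact: cut_zero.
by apply: contrapT => x0; apply: noA; exists x.
Qed.

Lemma cut_neq_top A x : A <> \top%O -> cut A x -> x <> one.
Proof.
move=> A1 Ax x1; apply: A1; apply: cut_inj; rewrite cut_top.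
apply/seteqP; split=> // y _; apply: cut_le Ax.
by rewrite x1; case/andP: (bnd y).
Qed.

(** A nonzero z in both A and its star satisfies z <= z', so z lies in L(z, z') = L(a, a').
    Conversely, z in L(a, a') is below a, hence in A; for each nonzero b in A, L(a, a') = L(b, b')
    gives z <= b'. Such z and b differ from [one] because A is not the top cut. *)
Lemma cut_meet_star A a : antitone_involution inv ->
  (forall x y, x <> zero -> x <> one -> y <> zero -> y <> one ->
     lbound [set x; inv x] = lbound [set y; inv y]) ->
  A <> \top%O -> cut A a -> a <> zero ->
  cut (A `&` DM_star inv A)%O = lbound [set a; inv a].
Proof.
move=> invP cst A1 Aa a0; have a1 := cut_neq_top A1 Aa.
rewrite cut_meet; apply/seteqP; split=> z.
  move=> [Az /(mem_star invP)/(_ z Az) zz'].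
  have [->|/eqP z0] := eqVneq z zero.
    by move=> y _; case/andP: (bnd y).
  have z1 := cut_neq_top A1 Az.
  by rewrite (cst a z)// => _ [->|->].
move=> zL; split; first by apply: cut_le Aa; apply: zL; left.
move=> _ [b Ab <-].
have [->|/eqP b0] := eqVneq b zero.
  by apply: (le_invr invP); case/andP: (bnd (inv z)).
have b1 := cut_neq_top A1 Ab.
by move: zL; rewrite (cst a b)//; apply; right.
Qed.

End Bounded.

(** Nonemptiness matters: for empty P, [DM P] has a single element and is vacuously consistent, yet
    P has no bounds. *)
Lemma consistent_lattice_bounded : antitone_involution inv ->
  [set: P] !=set0 -> consistent_lattice (L := DM P) (DM_star inv) ->
  exists zero one : P, forall x, (zero <= x <= one)%O.
Proof.
move=> invP [p _] [_ cst nz].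
suff [z zP] : exists z : P, forall x, (z <= x)%O.
  by exists z, (inv z) => x; rewrite zP; apply: (le_invr invP).
apply: contrapT => no0.
have Nbot x : principal x <> \bot%O.
  by move=> /principal_eq_bot xle; apply: no0; exists x.
have Ntop x : principal x <> \top%O.
  (* A greatest x would make x' least. *)
  move=> /principal_eq_top xge; apply: no0; exists (inv x) => y.
  exact: (le_invl invP).
have pq q : (principal p `&` principal (inv p))%O =
            (principal q `&` principal (inv q))%O.
  by rewrite -!star_principal//; apply: cst.
have [c cp] : cut (principal p `&` principal (inv p))%O !=set0.
  apply/set0P/eqP => m0; apply: (nz _ _ (Nbot p) (Nbot (inv p))).
  (* Without a least element L(P) is empty, so an empty meet would be the bottom cut. *)
  apply: cut_inj; rewrite m0 cut_bot; apply/esym/seteqP; split=> // x xP.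
  by apply: no0; exists x => y; apply: xP.
by apply: no0; exists c => q; move: cp; rewrite (pq q) => -[/mem_principal].
Qed.

End DedekindMacNeilleTheory.

Theorem theorem6 (d : Order.disp_t) (P : porderType d) (inv : P -> P)
    (P_neq0 : [set: P] !=set0) (invP : antitone_involution inv) :
  consistent_lattice (L := DM P) (DM_star inv) <-> consistent_poset inv.
Proof.
split=> [cl|[_ [zero [one [bnd cst nz]]]]].
  have [zero [one bnd]] := consistent_lattice_bounded invP P_neq0 cl.
  case: cl => _ cst nz; split=> //; exists zero, one; split=> //.
    move=> x y x0 x1 y0 y1; rewrite -!cut_principalI -!star_principal//.
    congr cut.
    by apply: cst; [apply: principal_neq_bot bnd _ x0|
      apply: principal_neq_top bnd _ x1|apply: principal_neq_bot bnd _ y0|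
      apply: principal_neq_top bnd _ y1].
  move=> x y x0 y0; rewrite -cut_principalI -(cut_bot_bounded bnd) => /cut_inj.
  by apply: nz; apply: principal_neq_bot bnd _ _.
split; first exact: star_antitone_involution.
  move=> A B A0 A1 B0 B1.
  have [a Aa a0] := cut_neq_bot bnd A0; have [b Bb b0] := cut_neq_bot bnd B0.
  apply: cut_inj; rewrite (cut_meet_star bnd invP cst A1 Aa a0).
  rewrite (cut_meet_star bnd invP cst B1 Bb b0).
  by apply: cst => //; [apply: (cut_neq_top bnd A1)|apply: (cut_neq_top bnd B1)].
move=> A B A0 B0 /(congr1 (@cut _ _)); rewrite cut_meet (cut_bot_bounded bnd).
have [a Aa a0] := cut_neq_bot bnd A0; have [b Bb b0] := cut_neq_bot bnd B0.
(* Since cuts are down-closed, L(a, b) lies in the intersection of A and B; were that only {0}, L(a,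
   b) would be {0} with a and b nonzero. *)
move=> AB; apply: (nz a b a0 b0); apply/seteqP; split=> [z zab|_ -> y _].
  rewrite -AB; split; [apply: cut_le Aa|apply: cut_le Bb]; apply: zab.
    by left.
  by right.
by case/andP: (bnd y).
Qed.
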